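(* Let $N\ge1$, let $T$ be the infinite $N$-ary tree, and let $\tilde T$ be the graph with the same vertices and edges as $T$ together with one additional loop edge from $\emptyset$ to itself. For $n\in\mathbb{N}$ let $N_{\tilde T}(n)$ be the number of paths of length $n$ in $\tilde T$ from $\emptyset$ to $\emptyset$, i.e., sequences $(w_0,w_1,\dots,w_n)$ of vertices with $w_0=w_n=\emptyset$ and $w_{k-1},w_k$ joined by an edge of $\tilde T$ for each $k$ (so $w_{k-1}=w_k=\emptyset$ is allowed via the loop). Let $\mu_{c+p}$ be the measure on $[-1,1]$ given by $$d\mu_{c+p}=\frac{\frac{2}{\pi}\sqrt{1-x^2}}{1-2N^{-1/2}x+N^{-1}}\,dx.$$ Then $$\int x^n\,d\mu_{c+p}(x)=\frac{1}{(2\sqrt N)^n}N_{\tilde T}(n),\qquad n\in\mathbb{N}.$$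
   Context: The infinite $N$-ary tree $T$ has vertex set the finite words over $\{1,\dots,N\}$ including the empty word $\emptyset$, and edges exactly the pairs $\{\omega,\omega i\}$, where $\omega i$ is $\omega$ with the letter $i\in\{1,\dots,N\}$ appended. *)

(* Defs.v *)
From HB Require Import structures.
From mathcomp Require Import all_boot all_order all_algebra.
From mathcomp Require Import all_classical all_reals all_analysis.
Set Implicit Arguments. Unset Strict Implicit. Unset Printing Implicit Defensive.
Import Order.TTheory GRing.Theory Num.Theory.

(* Vertices of the N-ary tree: finite words over the alphabet 'I_N
   (letters 0..N-1 play the role of 1..N); the root is the empty word [::].
   The word "omega i" is  rcons omega i. *)
Definition word (N : nat) := seq 'I_N.

Definition parent (N : nat) (w : word N) : word N := take (size w).-1 w.

Definition tneighbours (N : nat) (w : word N) : seq (word N) :=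
  [seq rcons w i | i <- enum 'I_N] ++
  (if w is [::] then [:: [::]] else [:: parent w]).

Definition tedge (N : nat) (u v : word N) : bool := v \in tneighbours u.

Fixpoint nwalks (N : nat) (n : nat) (v : word N) : nat :=
  match n with
  | 0 => (v == [::] :> word N)
  | k.+1 => \sum_(u <- tneighbours v) nwalks k u
  end.

Definition NTt (N n : nat) : nat := nwalks n ([::] : word N).

Local Open Scope ring_scope.

Definition mu_cp_density (R : realType) (N : nat) (x : R) : R :=
  (2 / pi * Num.sqrt (1 - x ^+ 2)) /
  (1 - 2 * (Num.sqrt (N%:R))^-1 * x + (N%:R)^-1).

(* Main.v *)
(* Put q = N^(-1/2), w = sqrt (1 - x^2) and D = 1 - 2 q x + q^2.  Let p_k be
   defined by p_0 = 1, p_1 = 2x - q and p_(k+2) = 2x p_(k+1) - p_k.  Scaled by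
   N^(k/2) / (2 sqrt N)^n, the number of walks of length n from a vertex at
   depth k to the root satisfies, in n, the recurrence which multiplication by x
   induces on the integrals of x^n p_k against mu_(c+p), so it suffices to compare
   the two at n = 0, that is, to show that p_k has integral [k = 0].
   Since p_k - q p_(k+1) = D U_k with U_k the Chebyshev polynomial of the second
   kind, and U_k has semicircle integral [k = 0], this reduces to mu_(c+p)
   having mass 1, which follows from an explicit primitive of w / D.
   For N = 1 the density blows up at x = 1, so the fundamental theorem of
   calculus is only applied on [-1, b] with b < 1. *)

Require Import Defs.
From HB Require Import structures.
From mathcomp Require Import all_boot all_order all_algebra.
From mathcomp Require Import all_classical all_reals all_analysis.
From mathcomp Require Import measurable_realfun ring lra.
Import Order.TTheory GRing.Theory Num.Theory.
Import numFieldNormedType.Exports.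
Local Open Scope classical_set_scope.
Local Open Scope ring_scope.

(** The degree-one term is a parameter: [p] = 2X gives the Chebyshev polynomials U_k of the second
    kind, [p] = 2X - q gives the p_k. *)
Fixpoint cheb {R : comNzRingType} (p : {poly R}) (k : nat) : {poly R} :=
  match k with
  | 0 => 1
  | 1 => p
  | (m.+1 as k').+1 => 'X *+ 2 * cheb p k' - cheb p m
  end.

(** * Identities between Chebyshev polynomials *)

Section chebyshev_algebra.
Context {R : comNzRingType}.
Implicit Types (p : {poly R}) (q : R).

Lemma chebSS p k : cheb p k.+2 = 'X *+ 2 * cheb p k.+1 - cheb p k.
Proof. by []. Qed.

Local Notation U := (cheb ('X *+ 2 : {poly R})).

(** Both sides obey the same three-term recurrence in k, so the cases k = 0, 1 decide; the induction
    therefore carries two consecutive indices. *)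
Lemma cheb_perturb q k :
  let P := cheb ('X *+ 2 - q%:P) in
  P k - q%:P * P k.+1 = (1 - q%:P * 'X *+ 2 + q%:P ^+ 2) * U k.
Proof.
move=> P; suff [] : P k - q%:P * P k.+1 = (1 - q%:P * 'X *+ 2 + q%:P ^+ 2) * U k /\
  P k.+1 - q%:P * P k.+2 = (1 - q%:P * 'X *+ 2 + q%:P ^+ 2) * U k.+1 by [].
elim: k => [|k [IH1 IH2]]; first by rewrite /P /=; split; ring.
split=> //; set D := (1 - _ + _) in IH1 IH2 *.
have -> : D * U k.+2 = 'X *+ 2 * (D * U k.+1) - D * U k.
  by rewrite chebSS; ring.
by rewrite -IH1 -IH2 /P (chebSS _ k.+1) (chebSS _ k); ring.
Qed.

(** Differentiating the recurrence expresses U_(k+2)' through U_(k+1)', U_k' and U_(k+1), so again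
    two consecutive indices are carried. *)
Lemma cheb_deriv k :
  (1 - 'X ^+ 2) * (U k)^`() = k.+2%:R * 'X * U k - k.+1%:R * U k.+1.
Proof.
suff [] : (1 - 'X ^+ 2) * (U k)^`() = k.+2%:R * 'X * U k - k.+1%:R * U k.+1 /\
  (1 - 'X ^+ 2) * (U k.+1)^`() = k.+3%:R * 'X * U k.+1 - k.+2%:R * U k.+2 by [].
elim: k => [|k [IH1 IH2]].
  by rewrite /= derivMn derivX -polyC1 derivC polyC1; split; ring.
split=> //; rewrite (chebSS _ k) derivB derivM derivMn derivX mulrBr IH1.
rewrite mulrDr [X in _ + X - _]mulrCA IH2.
rewrite (chebSS _ k.+1) (chebSS _ k).
rewrite -[k.+4]addn4 -[k.+3]addn3 -[k.+2]addn2 -[k.+1]addn1 !natrD; ring.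
Qed.

(* Q is (1 - X^2) times the derivative of U_(k+1), so this is the Chebyshev
   differential equation. *)
Lemma cheb_antideriv k (Q := k.+2%:R * U k - k.+1%:R * 'X * U k.+1) :
  - 'X * Q + (1 - 'X ^+ 2) * Q^`() =
  - (k.+1%:R * k.+3%:R) * ((1 - 'X ^+ 2) * U k.+1).
Proof.
have dn m : (m%:R : {poly R})^`() = 0 by rewrite -polyC_natr derivC.
rewrite /Q derivB !derivM derivX !dn !mul0r !add0r mulr1.
set D := 1 - _.
transitivity (- 'X * (k.+2%:R * U k - k.+1%:R * 'X * U k.+1) - k.+1%:R * D * U k.+1
    + k.+2%:R * (D * (U k)^`()) - k.+1%:R * 'X * (D * (U k.+1)^`())); first by ring.
rewrite !cheb_deriv {}/D.
rewrite (chebSS _ k).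
rewrite -[k.+3]addn3 -[k.+2]addn2 -[k.+1]addn1 !natrD; ring.
Qed.

End chebyshev_algebra.

(** * Primitives involving sqrt (1 - x^2), and an improper fundamental theorem of calculus *)

Section analysis.
Context {R : realType}.
Local Notation mu := (@lebesgue_measure R).

(** Supplies continuity at the endpoints, where [acos] is not differentiable: it is the inverse of
    the continuous injective [cos] on [0, pi]. *)
Lemma within_continuous_acos : {within `[-1, 1], continuous (@acos R)}.
Proof.
have cosin : {in `[0, pi], forall t : R, cos t \in `[-1, 1]%R}.
  by move=> t _; rewrite in_itv/= cos_geN1 cos_le1.
apply: segment_dec_surj_continuous.
  have /= := @segment_can_ge R 0 pi cos acos (pi_ge0 R).
  rewrite cos0 cospi; apply; last by move=> t /cosK.
  exact/continuous_subspaceT/continuous_cos.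
rewrite acos1 acosN1 => t tI /=; exists (cos t); first exact: cosin.
exact: cosK.
Qed.

(** Exhaust [a, b[ by segments [a, c n], apply the usual theorem on each and pass to the limit by
    monotone convergence; [f] may blow up at [b]. *)
Lemma ge0_FTC2_improper (f F : R -> R) (a b l : R) : a < b ->
  {in `]a, b[, continuous f} -> f x @[x --> a^'+] --> f a ->
  (forall x, a <= x < b -> 0 <= f x) ->
  (forall x, a < x < b -> is_derive x 1 F (f x)) ->
  F x @[x --> a^'+] --> F a -> F x @[x --> b^'-] --> l ->
  (\int[mu]_(x in `[a, b]) (f x)%:E = (l - F a)%:E)%E.
Proof.
move=> ab fC fa f0 dF Fa Fb.
(* The shift by 2 keeps [c n] strictly above [a] even for n = 0. *)
pose c (n : nat) := b - (b - a) / n.+2%:R.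
have ba0 : 0 < b - a by rewrite subr_gt0.
have cb n : c n < b by rewrite /c ltrBlDr ltrDl divr_gt0.
have ac n : a < c n.
  by rewrite /c ltrBrDr -ltrBrDl ltr_pdivrMr// ltr_pMr// ltr1n.
have c_cvg : c n @[n --> \oo] --> b^'-.
  have c_b : c n @[n --> \oo] --> b.
    rewrite -[X in _ --> X]subr0; apply: cvgB; first exact: cvg_cst.
    rewrite -(mulr0 (b - a)); apply: cvgMr.
    apply/gtr0_cvgV0; first by near=> n; rewrite ltr0n.
    have := @cvgr_idn R; rewrite -(cvg_shiftn 2) /=.
    by under eq_cvg do rewrite addn2.
  move=> P Pb; have : \forall n \near \oo, c n < b -> P (c n) by exact: (c_b _ Pb).
  by apply: filterS => n; exact.
have fW n : {within `[a, c n], continuous f}.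
  apply/continuous_within_itvP => //; split => //.
    move=> x; rewrite in_itv/= => /andP[ax xc]; apply: fC.
    by rewrite in_itv/= ax (lt_trans xc).
  apply: cvg_at_left_filter; apply: fC; by rewrite in_itv/= ac cb.
have mfn n : measurable_fun `[a, c n] f.
  exact: subspace_continuous_measurable_fun.
have intn n : (\int[mu]_(x in `[a, c n]) (f x)%:E = (F (c n) - F a)%:E)%E.
  rewrite (@continuous_FTC2 _ f F _ _ (ac n) (fW n)) //.
  - split => //.
      move=> x; rewrite in_itv/= => /andP[ax xc].
      by apply: ex_derive; apply: dF; rewrite ax (lt_trans xc).
    apply: cvg_at_left_filter; apply: differentiable_continuous.
    apply/derivable1_diffP; apply: ex_derive; apply: dF; by rewrite ac cb.
  - move=> x; rewrite in_itv/= => /andP[ax xc]; rewrite derive1E.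
    by apply: derive_val; apply: dF; rewrite ax (lt_trans xc).
have cU : \bigcup_n `[a, c n]%classic = `[a, b[%classic.
  apply/seteqP; split => [x [n _] /=|x /=]; rewrite !in_itv/= => /andP[ax xb].
    by rewrite ax (le_lt_trans xb).
  have : \forall n \near \oo, x < c n.
    exact: (c_cvg [set y | x < y] (nbhs_left_gt xb)).
  by case=> n _ /(_ n (leqnn n)) /= xc; exists n => //=; rewrite in_itv/= ax ltW.
have mf : measurable_fun `[a, b[ f.
  by rewrite -cU; apply/measurable_fun_bigcup.
rewrite -integral_itv_bndo_bndc; last exact/measurable_EFinP.
rewrite -cU.
have nd : nondecreasing_seq (fun n => `[a, c n]%classic).
  move=> m n mn; rewrite subsetEset => x /=; rewrite !in_itv/= => /andP[-> xc] /=.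
  apply: (le_trans xc); rewrite /c lerD2l lerN2 ler_pM2l//.
  by rewrite lef_pV2 ?posrE ?ltr0n// ler_nat.
(* The same sequence of integrals tends to the integral over [a, b[ and, by [intn], to [l - F a]. *)
have lim1 : (\int[mu]_(x in `[a, c n]) (f x)%:E @[n --> \oo]
    --> \int[mu]_(x in \bigcup_n `[a, c n]%classic) (f x)%:E)%E.
  apply: ge0_nondecreasing_set_cvg_integral => //.
    by move=> n; apply/measurable_EFinP; exact: mfn.
  move=> n x /=; rewrite in_itv/= => /andP[ax xc].
  by rewrite lee_fin f0// ax (le_lt_trans xc).
have lim2 : ((F (c n) - F a)%:E @[n --> \oo] --> (l - F a)%:E)%E.
  apply: cvg_EFin; first by near=> n.
  apply: cvgB; last exact: cvg_cst.
  exact: cvg_comp Fb.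
rewrite (funext intn) in lim1.
exact: (cvg_unique _ lim1 lim2).
Unshelve. all: by end_near. Qed.

Lemma continuous_sqrt_1Bsqr : continuous (fun x : R => Num.sqrt (1 - x ^+ 2)).
Proof.
move=> x; apply: continuous_comp; last exact: sqrt_continuous.
by apply: cvgB; [exact: cvg_cst | exact: exprn_continuous].
Qed.

Lemma is_derive_sqrt_1Bsqr (x : R) : -1 < x < 1 ->
 is_derive x 1 (fun x => Num.sqrt (1 - x^+2)) (- x / Num.sqrt (1 - x^+2)).
Proof.
move=> /andP[x1 x2].
have h : 0 < 1 - x^+2 by nra.
have d1 : is_derive x 1 (fun x : R => 1 - x ^+ 2) (- (2 * x)).
  apply: is_derive_eq; rewrite add0r /GRing.scale /=; ring.
have := @is_derive1_comp _ Num.sqrt (fun x : R => 1 - x ^+ 2) _ _ _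
  (is_derive1_sqrt h) d1.
move/is_derive_eq; apply.
by rewrite invfM; field; rewrite gt_eqF ?sqrtr_gt0.
Qed.

(* With x = cos t, the arctangent is minus the argument of 1 - q e^(it). *)
Lemma is_derive_weight_primitive (q x : R) : q != 0 -> -1 < x < 1 -> 0 < 1 - q * x ->
 is_derive x 1 (fun x => - (2 * q)^-1 * Num.sqrt (1 - x^+2) - 2^-1 * acos x
   + (1 - q^+2) / (2 * q^+2) * atan (q * Num.sqrt (1 - x^+2) / (1 - q * x)))
 (Num.sqrt (1 - x^+2) / (1 - 2 * q * x + q^+2)).
Proof.
move=> q0 xI qx.
have dw := is_derive_sqrt_1Bsqr _ xI.
have da := is_derive1_acos xI.
have d1 : is_derive x 1 (fun x : R => 1 - q * x) (- q).
  apply: is_derive_eq; rewrite add0r /GRing.scale /=; ring.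
have qx0 := lt0r_neq0 qx.
have dv : is_derive x 1 (fun x : R => (1 - q * x)^-1) (q / (1 - q * x)^+2).
  by apply: is_derive_eq; rewrite /GRing.scale /=; field.
have := is_deriveM (is_deriveM (is_derive_cst q x 1) dw) dv.
set z := (X in is_derive _ _ X) => dz.
have := is_derive1_comp (is_derive1_atan (z x)) dz.
set t := (_ \o _) => dt.
have := is_deriveD
  (is_deriveB (is_deriveZ (- (2 * q)^-1) dw) (is_deriveZ 2^-1 da))
  (is_deriveZ ((1 - q^+2) / (2 * q^+2)) dt).
move/is_derive_eq; apply.
rewrite /z /GRing.scale /=.
rewrite !fctE.
have w0 : 0 < 1 - x ^+ 2 by move: xI => /andP[? ?]; nra.
have hw := sqr_sqrtr (ltW w0).
have {}w0 : Num.sqrt (1 - x ^+ 2) != 0 by rewrite gt_eqF ?sqrtr_gt0.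
have D0 : 1 - 2 * q * x + q ^+ 2 != 0.
  by rewrite gt_eqF//; move: xI => /andP[? ?]; nra.
move: w0 hw D0; set w := Num.sqrt _; set D := 1 - 2 * q * x + _ => w0 hw D0.
(* This is (1 - qx)^2 + q^2 (1 - x^2) = D, i.e. D = |1 - q e^(it)|^2. *)
have -> : 1 + (q * w / (1 - q * x)) ^+ 2 = D / (1 - q * x) ^+ 2.
  rewrite exprMn exprVn exprMn hw /D; field; exact: qx0.
have -> : q * w * (q / (1 - q * x) ^+ 2) + (1 - q * x)^-1 * (q * (- x / w) + w * 0)
    = q * (q * w ^+ 2 - x * (1 - q * x)) / (w * (1 - q * x) ^+ 2).
  by field; rewrite qx0 w0.
have -> : w / D = w ^+ 2 / (w * D) by field; rewrite D0 w0.
rewrite hw; move: D0; rewrite /D => D0; field.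
by rewrite w0 q0 D0 qx0.
Qed.

(* The hypothesis says that Q w - c acos is a primitive of S w, where
   w = sqrt (1 - x^2). *)
Lemma poly_sqrt_antideriv (Q S : {poly R}) (c : R) :
  - 'X * Q + (1 - 'X ^+ 2) * Q^`() + c%:P = (1 - 'X ^+ 2) * S ->
  \int[mu]_(x in `[-1, 1]) (S.[x] * Num.sqrt (1 - x ^+ 2)) = c * pi.
Proof.
move=> QS.
pose F x := Q.[x] * Num.sqrt (1 - x ^+ 2) - c * acos x.
have N11 : -1 < 1 :> R by lra.
have /(continuous_within_itvP _ N11)[_ aN1 a1] := within_continuous_acos.
have QwC : continuous (fun x : R => Q.[x] * Num.sqrt (1 - x ^+ 2)).
  move=> x; apply: cvgM; first exact: continuous_horner.
  exact: continuous_sqrt_1Bsqr.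
rewrite /Rintegral (@continuous_FTC2 _ _ F) //.
- rewrite /F /= acosN1 acos1 sqrrN expr1n subrr sqrtr0 !mulr0 !add0r oppr0.
  by rewrite sub0r opprK.
- apply: continuous_subspaceT => x.
  by apply: cvgM; [exact: continuous_horner | exact: continuous_sqrt_1Bsqr].
- split.
  + move=> x; rewrite in_itv/= => xI.
    have dw := is_derive_sqrt_1Bsqr _ xI.
    have da := is_derive1_acos xI.
    by case: (is_deriveB (is_deriveM (is_derive_poly Q x) dw) (is_deriveZ c da)).
  + apply: cvgB; first exact: (cvg_at_right_filter (QwC _)).
    by apply: cvgM => //; exact: cvg_cst.
  + apply: cvgB; first exact: (cvg_at_left_filter (QwC _)).
    by apply: cvgM => //; exact: cvg_cst.
- move=> x; rewrite in_itv/= => xI; rewrite derive1E.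
  have dw := is_derive_sqrt_1Bsqr _ xI.
  have da := is_derive1_acos xI.
  have := is_deriveB (is_deriveM (is_derive_poly Q x) dw) (is_deriveZ c da).
  case=> _; rewrite -/F => ->; rewrite /GRing.scale /=.
  have w0 : 0 < 1 - x ^+ 2 by move: xI => /andP[? ?]; nra.
  have hw := sqr_sqrtr (ltW w0).
  have {}w0 : Num.sqrt (1 - x ^+ 2) != 0 by rewrite gt_eqF ?sqrtr_gt0.
  have := congr1 (fun P => P.[x]) QS; rewrite /= !hornerE /= => E; rewrite -hw in E.
  move: w0 E; set w := Num.sqrt _ => w0 E.
  (* Over the common denominator w, the numerator of the derivative is the left side of [QS] at
     x. *)
  transitivity ((- x * Q.[x] + w ^+ 2 * Q^`().[x] + c) / w); first by field.
  by rewrite E; field.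
Qed.

End analysis.

(** * Total mass and integrability of w / D *)

Section density.
Context {R : realType}.
Local Notation mu := (@lebesgue_measure R).
Variable q : R.
Hypotheses (q0 : 0 < q) (q1 : q <= 1).

Local Notation w x := (Num.sqrt (1 - x ^+ 2)).
Local Notation D x := (1 - 2 * q * x + q ^+ 2).

Lemma denom_gt0 (x : R) : x < 1 -> 0 < D x.
Proof. by move=> x1; have := q0; have := q1; nra. Qed.

Lemma onem_mul_gt0 (x : R) : x < 1 -> 0 < 1 - q * x.
Proof. by move=> x1; have := q0; have := q1; nra. Qed.

Lemma weight_continuous (x : R) : x < 1 ->
  {for x, continuous (fun x : R => w x / D x)}.
Proof.
move=> x1; apply: cvgM; first exact: continuous_sqrt_1Bsqr.
apply: cvgV; first by rewrite gt_eqF ?denom_gt0.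
apply: cvgD; last exact: cvg_cst.
apply: cvgB; first exact: cvg_cst.
by apply: cvgM; [exact: cvg_cst | exact: cvg_id].
Qed.

Lemma atan_arg_continuous (x : R) : 0 < 1 - q * x ->
  {for x, continuous (fun x : R => atan (q * w x / (1 - q * x)))}.
Proof.
move=> x1; apply: continuous_comp; last exact: continuous_atan.
apply: cvgM.
  by apply: cvgM; [exact: cvg_cst | exact: continuous_sqrt_1Bsqr].
apply: cvgV; first by rewrite gt_eqF.
apply: cvgB; first exact: cvg_cst.
by apply: cvgM; [exact: cvg_cst | exact: cvg_id].
Qed.

Lemma integral_weight :
  (\int[mu]_(x in `[(-1)%R, 1%R]) (w x / D x)%:E = (pi / 2)%:E)%E.
Proof.
have N11 : -1 < 1 :> R by lra.
have /(continuous_within_itvP _ N11)[_ aN1 a1] := within_continuous_acos (R := R).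
pose F (x : R) := - (2 * q)^-1 * w x - 2^-1 * acos x +
  (1 - q ^+ 2) / (2 * q ^+ 2) * atan (q * w x / (1 - q * x)).
(* At -1 only the [acos] term survives; 0 is the limit of [F] at 1 from the left. *)
have -> : pi / 2 = 0 - F (-1).
  rewrite /F sqrrN expr1n subrr sqrtr0 !mulr0 mul0r atan0 mulr0 acosN1; lra.
apply: ge0_FTC2_improper => //.
- by move=> x; rewrite in_itv/= => /andP[_]; exact: weight_continuous.
- by apply: cvg_at_right_filter; exact: weight_continuous.
- by move=> x /andP[_ x1]; rewrite divr_ge0// ltW ?denom_gt0.
- move=> x xI; apply: is_derive_weight_primitive => //; first by rewrite gt_eqF.
  by apply: onem_mul_gt0; case/andP: xI.
- apply: cvgD.
    apply: cvgB; apply: cvgM => //; try exact: cvg_cst.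
    by apply: cvg_at_right_filter; exact: continuous_sqrt_1Bsqr.
  apply: cvgM; first exact: cvg_cst.
  by apply: cvg_at_right_filter; apply: atan_arg_continuous; exact: onem_mul_gt0.
- rewrite -[X in _ --> X]addr0; apply: cvgD.
    rewrite -[X in _ --> X]subr0; apply: cvgB.
      rewrite -[X in _ --> X](mulr0 (- (2 * q)^-1)).
      apply: cvgM; first exact: cvg_cst.
      have := cvg_at_left_filter (continuous_sqrt_1Bsqr (1 : R)).
      by rewrite expr1n subrr sqrtr0.
    rewrite -[X in _ --> X](mulr0 (2^-1)) -acos1.
    by apply: cvgM; first exact: cvg_cst.
  (* For q = 1 the arctangent's argument has a vanishing denominator at 1, but the coefficient 1 -
     q^2 kills the term; for q < 1 the term is continuous at 1. *)
  have [q1'|q1'|->] := ltrgtP q 1; last first.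
  + by rewrite expr1n subrr mul0r; under eq_cvg do rewrite mul0r; exact: cvg_cst.
  + by move: q1; rewrite leNgt q1'.
  + rewrite -[X in _ --> X](mulr0 ((1 - q ^+ 2) / (2 * q ^+ 2))).
    apply: cvgM; first exact: cvg_cst.
    have q10 : 0 < 1 - q * 1 by lra.
    have := cvg_at_left_filter (atan_arg_continuous _ q10).
    by rewrite expr1n subrr sqrtr0 mulr0 mul0r atan0.
Qed.

Lemma weight_ge0 (x : R) : -1 <= x <= 1 -> 0 <= w x / D x.
Proof.
move=> /andP[_ x1]; rewrite divr_ge0//.
by have := q0; have := q1; have := x1; nra.
Qed.

Lemma integrable_weight : mu.-integrable `[-1, 1] (fun x : R => (w x / D x)%:E).
Proof.
apply/integrableP; split.
  (* Both endpoints are discarded, since for q = 1 continuity fails at 1. *)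
  apply/measurable_EFinP/measurable_fun_itv_bndo_bndcP.
  apply/measurable_fun_itv_obnd_cbndP.
  apply: open_continuous_measurable_fun; first exact: interval_open.
  by move=> x; rewrite inE/= in_itv/= => /andP[_]; exact: weight_continuous.
have -> : (\int[mu]_(x in `[(-1)%R, 1%R]) `|(w x / D x)%:E| =
    \int[mu]_(x in `[(-1)%R, 1%R]) (w x / D x)%:E)%E.
  apply: eq_integral => x; rewrite inE/= in_itv/= => xI.
  by rewrite ger0_norm ?weight_ge0.
by rewrite integral_weight ltry.
Qed.

End density.

(** * Integration of polynomials against an integrable density *)

Section polymean.
Context {R : realType}.
Local Notation mu := (@lebesgue_measure R).
Variable g : R -> R.
Hypothesis gint : mu.-integrable `[-1, 1] (EFin \o g).

Definition polymean (P : {poly R}) : R := \int[mu]_(x in `[-1, 1]) (P.[x] * g x).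

Lemma integrable_poly_mul (P : {poly R}) :
  mu.-integrable `[-1, 1] (EFin \o (fun x => P.[x] * g x)).
Proof.
have PC : {within `[-1, 1], continuous (horner P)}.
  by apply: continuous_subspaceT; exact: continuous_horner.
apply: (@integrableMr _ _ _ mu _ _ (horner P) (EFin \o g)) => //.
  exact: subspace_continuous_measurable_fun.
have /compact_bounded[M [_ Mb]] := continuous_compact PC (@segment_compact R (-1) 1).
exists M; split; first exact: num_real.
by move=> y My x xI; apply: Mb => //; exists x.
Qed.

Lemma EFin_polymean (P : {poly R}) :
  ((polymean P)%:E = \int[mu]_(x in `[(-1)%R, 1%R]) (P.[x] * g x)%:E)%E.
Proof.
by rewrite /polymean /Rintegral fineK//; apply: integrable_fin_num => //;
  exact: integrable_poly_mul.
Qed.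

Lemma polymeanD P1 P2 : polymean (P1 + P2) = polymean P1 + polymean P2.
Proof.
rewrite /polymean -RintegralD//; try exact: integrable_poly_mul.
by apply: eq_Rintegral => x _; rewrite hornerD mulrDl.
Qed.

Lemma polymeanZ c P : polymean (c *: P) = c * polymean P.
Proof.
rewrite /polymean -RintegralZl//; last exact: integrable_poly_mul.
by apply: eq_Rintegral => x _; rewrite hornerZ mulrA.
Qed.

Lemma polymeanB P1 P2 : polymean (P1 - P2) = polymean P1 - polymean P2.
Proof. by rewrite -scaleN1r polymeanD polymeanZ mulN1r. Qed.

End polymean.

(** * Semicircle integrals of the U_k *)

Section walks.
Context {R : realType}.
Local Notation mu := (@lebesgue_measure R).
Local Notation w x := (Num.sqrt (1 - x ^+ 2)).

Lemma Rintegral_chebU_sqrt k :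
  \int[mu]_(x in `[-1, 1]) ((cheb ('X *+ 2 : {poly R}) k).[x] * w x) =
  (k == 0)%:R * (pi / 2).
Proof.
case: k => [|k].
  rewrite eqxx mul1r mulrC.
  (* The primitive of w used here is (x w - acos x) / 2. *)
  apply: (@poly_sqrt_antideriv _ (2^-1 *: 'X)) => /=.
  rewrite derivZ derivX -!mul_polyC.
  transitivity (2^-1%:P *+ 2 * (1 - 'X ^+ 2) : {poly R}); first by ring.
  by rewrite -polyCMn -(mulr_natr 2^-1) mulVf// mul1r mulr1.
rewrite mul0r -(mul0r pi).
have c0 : k.+1%:R * k.+3%:R != 0 :> R by rewrite mulf_neq0 ?pnatr_eq0.
(* By [cheb_antideriv], this polynomial times w is a primitive of U_(k+1) w, with no [acos] term; it
   vanishes at -1 and 1. *)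
apply: (@poly_sqrt_antideriv _ ((- (k.+1%:R * k.+3%:R)^-1) *:
  (k.+2%:R * cheb ('X *+ 2) k - k.+1%:R * 'X * cheb ('X *+ 2) k.+1))).
rewrite addr0 derivZ -!scalerAr -scalerDr cheb_antideriv.
rewrite -!polyC_natr -polyCM -polyCN mul_polyC scalerA mulNr mulrN opprK.
by rewrite mulVf// scale1r.
Qed.

(** * Integrals of the p_k against mu_(c+p) *)

Section moments.
Variable q : R.
Hypotheses (q0 : 0 < q) (q1 : q <= 1).
Local Notation D x := (1 - 2 * q * x + q ^+ 2).
Local Notation dens := (fun x : R => 2 / pi * w x / D x).
Local Notation L := (polymean dens).
Local Notation P := (cheb ('X *+ 2 - q%:P)).

Lemma integrable_dens : mu.-integrable `[-1, 1] (EFin \o dens).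
Proof.
have h := integrable_weight _ q0 q1.
have -> : EFin \o dens = (fun x => (2 / pi)%:E * (w x / D x)%:E)%E.
  by apply/funext => x /=; rewrite -EFinM mulrA.
by apply: integrableZl h.
Qed.

Lemma polymean1 : L 1 = 1.
Proof.
have pi0 : pi != 0 :> R by rewrite gt_eqF ?pi_gt0.
transitivity (\int[mu]_(x in `[-1, 1]) (2 / pi * (w x / D x))).
  by apply: eq_Rintegral => x _; rewrite hornerC mul1r -mulrA.
rewrite RintegralZl//.
  (* [field] would unfold [pi], hence the generalization. *)
  by rewrite /Rintegral integral_weight//=; move: (pi : R) pi0 => p p0; field.
exact: integrable_weight.
Qed.

Lemma polymean_denom (U : {poly R}) :
  L ((1 - q%:P * 'X *+ 2 + q%:P ^+ 2) * U) =
  2 / pi * \int[mu]_(x in `[-1, 1]) (U.[x] * w x).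
Proof.
rewrite -RintegralZl//; last first.
  apply: integrable_poly_mul.
  apply: continuous_compact_integrable; first exact: segment_compact.
  by apply: continuous_subspaceT; exact: continuous_sqrt_1Bsqr.
apply: eq_Rintegral => x; rewrite inE/= in_itv/= => /andP[_ x1].
rewrite hornerM.
have -> : (1 - q%:P * 'X *+ 2 + q%:P ^+ 2 : {poly R}).[x] = D x.
  by rewrite !hornerE /=; ring.
(* For q = 1 the denominator vanishes at x = 1, but so does the numerator. *)
have [->|xn1] := eqVneq x 1.
  by rewrite expr1n subrr sqrtr0 !(mulr0, mul0r).
have D0 : D x != 0 by rewrite gt_eqF// denom_gt0// lt_neqAle xn1.
by move: (2 / pi : R) => c; field.
Qed.

(** Integrating p_j - q p_(j+1) = D U_j gives [rec]. As q is nonzero, mass 1 forces the integral of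
    p_1 to be 0, and then those of all later p_k. *)
Lemma polymean_cheb k : L (P k) = (k == 0)%:R.
Proof.
have pi0 : pi != 0 :> R by rewrite gt_eqF ?pi_gt0.
have rec j : L (P j) - q * L (P j.+1) = (j == 0)%:R.
  rewrite -polymeanZ; last exact: integrable_dens.
  rewrite -polymeanB; last exact: integrable_dens.
  rewrite -mul_polyC cheb_perturb polymean_denom Rintegral_chebU_sqrt.
  by move: (pi : R) pi0 => p p0; field.
elim: k => [|k IH]; first exact: polymean1.
have := rec k; rewrite IH => /eqP; rewrite subr_eq addrC -subr_eq subrr.
by rewrite eq_sym mulf_eq0 gt_eqF//= => /eqP ->.
Qed.

End moments.

(** * Walks to the root and moments *)

Lemma sqrtn_ge1 (N : nat) : (0 < N)%N -> 1 <= Num.sqrt N%:R :> R.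
Proof. by move=> N0; rewrite -[leLHS]sqrtr1 ler_wsqrtr// ler1n. Qed.

(** Induction on the length, for all starting vertices at once, splitting off the first step. Moving
    to children or to the parent matches 2x p_k = p_(k+1) + p_(k-1), and the loop at the root
    matches 2x p_0 = p_1 + q p_0. *)
Lemma polymean_walks (N : nat) (n : nat) (v : word N) (q := (Num.sqrt N%:R)^-1 : R) :
  (0 < N)%N ->
  polymean (fun x : R => 2 / pi * w x / (1 - 2 * q * x + q ^+ 2))
    ('X ^+ n * cheb ('X *+ 2 - q%:P) (size v)) =
  (nwalks n v)%:R * Num.sqrt N%:R ^+ size v / (2 * Num.sqrt N%:R) ^+ n.
Proof.
move=> N0.
set s : R := Num.sqrt N%:R.
have s2 : s ^+ 2 = N%:R by rewrite sqr_sqrtr.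
have s1 : 1 <= s by exact: sqrtn_ge1.
have s0 : s != 0 by rewrite gt_eqF// (lt_le_trans _ s1).
have q0 : 0 < q by rewrite invr_gt0 (lt_le_trans _ s1).
have q1 : q <= 1 by rewrite invf_le1 ?(lt_le_trans _ s1).
have gi := integrable_dens _ q0 q1.
set L := polymean _; set P := cheb _.
have half : (2^-1%:P : {poly R}) *+ 2 = 1.
  by rewrite -polyCMn -(mulr_natr 2^-1) mulVf.
elim: n v => [|n IH] v.
  rewrite expr0 mul1r divr1 /L polymean_cheb// size_eq0.
  by case: v => [|? ?]; rewrite /= ?expr0 ?mul1r ?mul0r.
have child i : L ('X ^+ n * P (size v).+1) =
    (nwalks n (rcons v i))%:R * s ^+ (size v).+1 / (2 * s) ^+ n.
  by rewrite -(size_rcons v i) IH.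
rewrite /= /tneighbours big_cat big_map /= natrD natr_sum.
set X := L _ in child.
(* By induction the count depends only on depth, so the N children contribute equally; N = s^2 then
   absorbs the scaling. *)
have -> : \sum_(i <- enum 'I_N) (nwalks n (rcons v i))%:R
    = N%:R * (X / s ^+ (size v).+1 * (2 * s) ^+ n) :> R.
  rewrite (eq_bigr (fun=> X / s ^+ (size v).+1 * (2 * s) ^+ n)); last first.
    move=> i _; rewrite (child i); field.
    by rewrite !expf_neq0 ?mulf_neq0// pnatr_eq0.
  by rewrite big_const_seq count_predT size_enum_ord iter_addr_0 -[LHS]mulr_natl.
have st0 : (2 * s) ^+ n != 0 by rewrite expf_neq0 ?mulf_neq0// pnatr_eq0.
(* At the root the remaining neighbour is the root itself, through the loop; elsewhere it is the
   parent. *)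
case: v @X child => [|a v] X child.
  have -> : (\sum_(i <- [:: ([::] : word N)]) nwalks n i =
      nwalks n ([::] : word N))%N.
    by rewrite big_seq1.
  have -> : (nwalks n ([::] : word N))%:R = L ('X ^+ n) * (2 * s) ^+ n.
    by have := IH [::]; rewrite /= mulr1 expr0 mulr1 => ->; rewrite divfK.
  have -> : 'X ^+ n.+1 * P (@size 'I_N [::]) =
      2^-1 *: ('X ^+ n * P 1 + q *: 'X ^+ n).
    rewrite /P /= mulr1 -!mul_polyC -[LHS]mul1r -half exprSr; ring.
  rewrite /L polymeanZ// polymeanD// polymeanZ// -/L -/X -s2.
  move: (L _) => Y; rewrite /q -/s expr0 expr1 (exprS (2 * s)).
  by field; rewrite s0 st0.
have sp : size (parent (a :: v)) = size v by rewrite /parent size_take /= ltnSn.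
have -> : (\sum_(i <- [:: parent (a :: v)]) nwalks n i =
    nwalks n (parent (a :: v)))%N.
  by rewrite big_seq1.
have -> : (nwalks n (parent (a :: v)))%:R =
    L ('X ^+ n * P (size v)) / s ^+ size v * (2 * s) ^+ n.
  by rewrite -sp IH sp; field; rewrite st0 expf_neq0.
have -> : 'X ^+ n.+1 * P (size (a :: v)) =
    2^-1 *: ('X ^+ n * P (size v).+2 + 'X ^+ n * P (size v)).
  rewrite -mulrDr /P chebSS subrK -mul_polyC.
  rewrite -[LHS]mul1r -half exprSr [size (a :: v)]/=; ring.
rewrite /L polymeanZ// polymeanD// -/L -/X -s2.
move: (L _) => Y; rewrite [size (a :: v)]/= !(exprS s) (exprS (2 * s)).
by field; rewrite s0 st0 expf_neq0.
Qed.

End walks.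

Theorem theorem4p11 (R : realType) (N : nat) (hN : (1 <= N)%N) (n : nat) :
  (\int[@lebesgue_measure R]_(x in `[(-1)%R, 1%R]) ((x ^+ n * mu_cp_density N x)%:E))%E
  = (((NTt N n)%:R / (2 * Num.sqrt (N%:R)) ^+ n : R)%:E).
Proof.
have := @polymean_walks R N n [::] hN.
set q := (Num.sqrt N%:R)^-1; rewrite /= expr0 !mulr1 /NTt => <-.
have s1 := @sqrtn_ge1 R N hN.
have q0 : 0 < q by rewrite invr_gt0 (lt_le_trans _ s1).
have q1 : q <= 1 by rewrite invf_le1 ?(lt_le_trans _ s1).
rewrite (EFin_polymean _ (integrable_dens q q0 q1)).
apply: eq_integral => x _ /=.
(* The two denominators agree because q^2 = 1/N. *)
by rewrite hornerXn /mu_cp_density -/q exprVn sqr_sqrtr.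
Qed.
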